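(* Let $X_1,\dots,X_n$ ($n\ge d+1$) be i.i.d. $d$-dimensional random vectors whose distribution is absolutely continuous with respect to Lebesgue measure, with scaled residuals $Y_{n,1},\dots,Y_{n,n}$, and for $\gamma>0$ let $T_{n,\gamma}$ be the statistic defined in the context. Then (on the almost sure event that the sample covariance matrix is invertible) $$\lim_{\gamma\to\infty}\gamma^{3+d/2}\,\frac{96\,T_{n,\gamma}}{n\,\pi^{d/2}}=2b_{1,d}+3\widetilde b_{1,d},$$ where $$b_{1,d}=\frac1{n^2}\sum_{j,k=1}^n\left(Y_{n,j}^\top Y_{n,k}\right)^3,\qquad \widetilde b_{1,d}=\frac1{n^2}\sum_{j,k=1}^nY_{n,j}^\top Y_{n,k}\,\|Y_{n,j}\|^2\,\|Y_{n,k}\|^2.$$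
   Context: Let $\overline X_n=n^{-1}\sum_{j=1}^nX_j$ and $S_n=n^{-1}\sum_{j=1}^n(X_j-\overline X_n)(X_j-\overline X_n)^\top$. For $n\ge d+1$ the matrix $S_n$ is invertible almost surely, $S_n^{-1/2}$ denotes the symmetric positive definite square root of $S_n^{-1}$, and the scaled residuals are $Y_{n,j}=S_n^{-1/2}(X_j-\overline X_n)$, $j=1,\dots,n$. Put $$R_n(t)=\frac1n\sum_{j=1}^n\cos(t^\top Y_{n,j}),\quad M_n(t)=\frac1n\sum_{j=1}^n\exp(t^\top Y_{n,j}),\quad U_n(t)=\sqrt n\,(R_n(t)M_n(t)-1),\quad t\in\mathbb{R}^d,$$ and, for $\gamma>0$, $w_\gamma(t)=\exp(-\gamma\|t\|^2)$ and $$T_{n,\gamma}=\int_{\mathbb{R}^d}U_n^2(t)\,w_\gamma(t)\,dt.$$ $\|\cdot\|$ is the Euclidean norm. *)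

(* Defs.v *)
From HB Require Import structures.
From mathcomp Require Import all_boot all_order all_algebra.
From mathcomp Require Import all_classical all_reals all_analysis.

Set Implicit Arguments.
Unset Strict Implicit.
Unset Printing Implicit Defensive.

Import Order.TTheory GRing.Theory Num.Theory.
Import numFieldNormedType.Exports.

Local Open Scope classical_set_scope.
Local Open Scope ring_scope.

(* The Borel sigma-algebra of R^d, vectors being column vectors: it is the
   sigma-algebra generated by the coordinate maps. *)
Section measurable_cV.
Context {R : realType} {d : nat}.

Let coors : 'I_d -> 'cV[R]_d -> R := fun i v => v i ord0.

Let cV_set0 : g_sigma_preimage coors set0.
Proof. exact: sigma_algebra0. Qed.

Let cV_setC A : g_sigma_preimage coors A -> g_sigma_preimage coors (~` A).
Proof. exact: sigma_algebraC. Qed.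

Let cV_bigcup (F : _^nat) : (forall i, g_sigma_preimage coors (F i)) ->
  g_sigma_preimage coors (\bigcup_i (F i)).
Proof. exact: sigma_algebra_bigcup. Qed.

HB.instance Definition _ := @isMeasurable.Build default_measure_display
  'cV[R]_d (g_sigma_preimage coors) cV_set0 cV_setC cV_bigcup.

Lemma measurable_coord (i : 'I_d) :
  measurable_fun [set: 'cV[R]_d] (fun v : 'cV[R]_d => v i ord0).
Proof.
move=> _ Y mY; rewrite setTI; apply: sub_sigma_algebra => /=.
rewrite -bigcup_seq/=; exists i => /=; first by rewrite mem_index_enum.
by exists Y => //; rewrite setTI.
Qed.

Lemma measurable_fun_cV d' (T : measurableType d') (f : T -> 'cV[R]_d) :
  (forall i, measurable_fun [set: T] (fun x => f x i ord0)) ->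
  measurable_fun [set: T] f.
Proof.
move=> mf; apply: (@measurability _ _ _ _ _ _
  (\big[setU/set0]_(i < d) preimage_set_system setT (coors i) measurable)) => //.
move=> _ [B + <-]; rewrite -bigcup_seq/= => -[i _ [A mA <-]].
by rewrite !setTI -comp_preimage -[X in measurable X]setTI; exact: mf.
Qed.

End measurable_cV.

(* In the library the sigma-finite instance on products is shadowed by the one
   for products of subprobabilities. *)
Lemma sigma_finite_prod d1 d2 (T1 : measurableType d1) (T2 : measurableType d2)
    (R : realType) (m1 : {sigma_finite_measure set T1 -> \bar R})
    (m2 : {sigma_finite_measure set T2 -> \bar R}) :
  sigma_finite setT (m1 \x m2)%E.
Proof.
have /sigma_finiteP[F [TF ndF Foo]] := sigma_finiteT m1.
have /sigma_finiteP[G [TG ndG Goo]] := sigma_finiteT m2.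
exists (fun n => F n `*` G n).
  rewrite -setXTT TF TG predeqE => -[x y]; split.
    move=> [/= [n _ Fnx] [k _ Gky]]; exists (maxn n k) => //; split.
    - by move: x Fnx; exact/subsetPset/ndF/leq_maxl.
    - by move: y Gky; exact/subsetPset/ndG/leq_maxr.
  by move=> [n _ []/= ? ?]; split; exists n.
move=> k; have [? ?] := Foo k; have [? ?] := Goo k.
split; first exact: measurableX.
by rewrite product_measure1E// lte_mul_pinfty// ge0_fin_numE.
Qed.

(* Lebesgue measure on R^d, as the d-fold product of the one-dimensional one. *)
Section lebesgue_cV.
Context {R : realType}.

Definition vcons d (p : measurableTypeR R * 'cV[R]_d) : 'cV[R]_d.+1 :=
  (col_mx p.1%:M p.2 : 'cV[R]_(1 + d)).

Definition vuncons d (v : 'cV[R]_d.+1) : measurableTypeR R * 'cV[R]_d :=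
  (v ord0 ord0, dsubmx (v : 'cV[R]_(1 + d))).

Lemma vconsE0 d (p : measurableTypeR R * 'cV[R]_d) : vcons p ord0 ord0 = p.1.
Proof.
have -> : (ord0 : 'I_d.+1) = lshift d (ord0 : 'I_1) by exact: val_inj.
by rewrite (@col_mxEu _ 1 d 1 p.1%:M p.2) mxE eqxx mulr1n.
Qed.

Lemma vconsES d (p : measurableTypeR R * 'cV[R]_d) i :
  vcons p (lift ord0 i) ord0 = p.2 i ord0.
Proof.
have -> : lift ord0 i = rshift 1 i :> 'I_d.+1 by exact: val_inj.
exact: (@col_mxEd _ 1 d 1 p.1%:M p.2).
Qed.

Lemma vconsK d : cancel (@vcons d) (@vuncons d).
Proof. by case=> x v; rewrite /vuncons vconsE0 /vcons col_mxKd. Qed.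

Lemma measurable_vcons d : measurable_fun setT (@vcons d).
Proof.
apply: measurable_fun_cV => i; case: (unliftP ord0 i) => [j ->|->].
- apply: (eq_measurable_fun (fun p : measurableTypeR R * 'cV[R]_d =>
    p.2 j ord0)).
    by move=> p _; rewrite vconsES.
  exact: (measurableT_comp (measurable_coord j)).
- apply: (eq_measurable_fun (fun p : measurableTypeR R * 'cV[R]_d => p.1)).
    by move=> p _; rewrite vconsE0.
  exact: measurable_fst.
Qed.

Lemma measurable_vuncons d : measurable_fun setT (@vuncons d).
Proof.
apply: measurable_fun_pair; first exact: measurable_coord.
apply: measurable_fun_cV => i.
apply: (eq_measurable_fun (fun v : 'cV[R]_d.+1 => v (rshift 1 i) ord0)).
  by move=> v _; rewrite mxE.
exact: measurable_coord.
Qed.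

Section step.
Context d (mu : {sigma_finite_measure set 'cV[R]_d -> \bar R}).

Definition lebesgue_step : set 'cV[R]_d.+1 -> \bar R :=
  pushforward (lebesgue_measure \x mu)%E (@vcons d).

Let lebesgue_step0 : lebesgue_step set0 = 0%E.
Proof. by rewrite /lebesgue_step /pushforward preimage_set0 measure0. Qed.

Let lebesgue_step_ge0 A : (0 <= lebesgue_step A)%E.
Proof. by rewrite /lebesgue_step /pushforward measure_ge0. Qed.

Let lebesgue_step_sigma_additive : semi_sigma_additive lebesgue_step.
Proof.
move=> F mF tF mUF; rewrite /lebesgue_step /pushforward preimage_bigcup.
apply: measure_sigma_additive.
- by move=> n; rewrite -[X in measurable X]setTI; exact: measurable_vcons.
- apply/trivIsetP => /= i j _ _ ij; rewrite -preimage_setI.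
  by move/trivIsetP : tF => /(_ _ _ _ _ ij) ->//; rewrite preimage_set0.
Qed.

HB.instance Definition _ := isMeasure.Build _ _ _ lebesgue_step
  lebesgue_step0 lebesgue_step_ge0 lebesgue_step_sigma_additive.

Let lebesgue_step_sigma_finite : sigma_finite setT lebesgue_step.
Proof.
have [F FT mF] : sigma_finite setT (@lebesgue_measure R \x mu)%E.
  exact: sigma_finite_prod.
exists (fun n => @vuncons d @^-1` F n).
  by rewrite -preimage_bigcup -FT preimage_setT.
move=> n; have [mFn Fnoo] := mF n; split.
  by rewrite -[X in measurable X]setTI; exact: measurable_vuncons.
rewrite /lebesgue_step /pushforward -comp_preimage.
by rewrite (_ : _ \o _ = id) //; apply/funext => p; exact: vconsK.
Qed.

HB.instance Definition _ :=
  Measure_isSigmaFinite.Build _ _ _ lebesgue_step lebesgue_step_sigma_finite.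

End step.

Fixpoint lebesgue_cV d : {sigma_finite_measure set 'cV[R]_d -> \bar R} :=
  match d with
  | 0 => \d_(0 : 'cV[R]_0)
  | k.+1 => lebesgue_step (lebesgue_cV k)
  end.

End lebesgue_cV.
Arguments lebesgue_cV R d : clear implicits.

Lemma lebesgue_cV_box (R : realType) d (A : 'I_d -> set (measurableTypeR R)) :
  (forall i, measurable (A i)) ->
  lebesgue_cV R d [set v : 'cV[R]_d | forall i, A i (v i ord0)] =
  (\prod_(i < d) lebesgue_measure (A i))%E.
Proof.
elim: d A => [|d IH] A mA.
  by rewrite big_ord0 /= diracE mem_set //= => -[].
rewrite big_ord_recl -(IH (fun i => A (lift ord0 i))); last first.
  by move=> i; exact: mA.
have mB : measurable [set v : 'cV[R]_d | forall i, A (lift ord0 i) (v i ord0)].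
  rewrite [X in measurable X](_ : _ = \bigcap_(i in [set: 'I_d])
      ((fun v : 'cV[R]_d => v i ord0) @^-1` A (lift ord0 i))).
    apply: fin_bigcap_measurable => // i _.
    rewrite -[X in measurable X]setTI;
      exact: (@measurable_coord R d i measurableT _ (mA (lift ord0 i))).
  by apply/seteqP; split => v /= h i; [move=> _|]; exact: h.
rewrite -product_measure1E//.
rewrite /= /lebesgue_step /pushforward; congr (_ _).
apply/seteqP; split=> -[x v] /=.
  move=> h; split; first by have := h ord0; rewrite vconsE0.
  by move=> i; have := h (lift ord0 i); rewrite vconsES.
move=> [h0 h] i; case: (unliftP ord0 i) => [j ->|->].
  by rewrite vconsES; exact: h.
by rewrite vconsE0.
Qed.

Section iid.
Context disp (Omega : measurableType disp) (R : realType).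
Context (P : probability Omega R).
Context disp' (T : measurableType disp') (n : nat).

Definition mutually_independent (X : 'I_n -> {RV P >-> T}) :=
  forall (J : {set 'I_n}) (A : 'I_n -> set T),
    (forall j, measurable (A j)) ->
    P (\bigcap_(j in [set` J]) (X j @^-1` A j)) =
    (\prod_(j in J) P (X j @^-1` A j))%E.

Definition identically_distributed (X : 'I_n -> {RV P >-> T}) :=
  forall (j k : 'I_n) (A : set T), measurable A ->
    distribution P (X j) A = distribution P (X k) A.

End iid.

Section statistic.
Context {R : realType} {d : nat}.
Implicit Types (u v t : 'cV[R]_d) (A B : 'M[R]_d).

Definition dotv u v : R := (u^T *m v) ord0 ord0.

(* The library norm `|v| on matrices is the sup norm. *)
Definition enorm v : R := Num.sqrt (dotv v v).

Definition sym_posdef A : Prop :=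
  A^T = A /\ forall v, v != 0 -> 0 < dotv v (A *m v).

(* The symmetric positive definite square root of A; meaningful when A is
   itself symmetric positive definite, in which case the root exists and is
   unique. *)
Definition sqrtmx A : 'M[R]_d :=
  xget 0 [set B | sym_posdef B /\ B *m B = A].

Section sample.
Context {n : nat} (x : 'I_n -> 'cV[R]_d).

Definition sample_mean : 'cV[R]_d := n%:R^-1 *: \sum_(j < n) x j.

Definition sample_cov : 'M[R]_d :=
  n%:R^-1 *: \sum_(j < n) (x j - sample_mean) *m (x j - sample_mean)^T.

Definition scaled_residual (j : 'I_n) : 'cV[R]_d :=
  sqrtmx (invmx sample_cov) *m (x j - sample_mean).

Local Notation Y := scaled_residual.

Definition Rn t : R := n%:R^-1 * \sum_(j < n) cos (dotv t (Y j)).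

Definition Mn t : R := n%:R^-1 * \sum_(j < n) expR (dotv t (Y j)).

Definition Un t : R := Num.sqrt n%:R * (Rn t * Mn t - 1).

Definition weight (gamma : R) t : R := expR (- gamma * enorm t ^+ 2).

Definition Tn (gamma : R) : R :=
  \int[lebesgue_cV R d]_t (Un t ^+ 2 * weight gamma t).

Definition b1 : R :=
  (n%:R ^+ 2)^-1 * \sum_(j < n) \sum_(k < n) dotv (Y j) (Y k) ^+ 3.

Definition b1_tilde : R :=
  (n%:R ^+ 2)^-1 * \sum_(j < n) \sum_(k < n)
    dotv (Y j) (Y k) * enorm (Y j) ^+ 2 * enorm (Y k) ^+ 2.

End sample.
End statistic.

(* Main.v *)
(* Part 1.  If the sample covariance is singular, all X_j lie in one affine
   hyperplane, so any d+1 of the vectors (1, X_j) are linearly dependent.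
   Adding the vectors one at a time, the new one would have to fall, given the
   others, in a hyperplane determined by them; by independence (Fubini) and
   absolute continuity this has probability zero.

   Part 2.  It is deterministic.  Write a_j = t . Y_j and m_k for the mean of the
   a_j^k.  As m_1 = 0, Taylor expansion gives R = 1 - m_2 / 2 + O(|t|^4) and
   M = 1 + m_2 / 2 + m_3 / 6 + O(|t|^4) e^{O(|t|)}: the second moments cancel and
   (R M - 1)^2 = (m_3 / 6)^2 + O(|t|^7) e^{O(|t|)}.  Against the weight
   exp(-g |t|^2) the error contributes O(g^{-1/2}) after normalization, because
   |t|^7 is at most a constant times g^{-7/2} exp(g |t|^2 / 4).  The main term
   is a combination of (t . a)^3 (t . b)^3, hence by polarization of sixth powers
   (t . c)^6, whose Gaussian integrals follow from those of exp(t . c). *)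
Require Import Defs.
From HB Require Import structures.
From mathcomp Require Import all_boot all_order all_algebra.
From mathcomp Require Import all_classical all_reals all_analysis.
From mathcomp Require Import measurable_realfun ring lra.

Set Implicit Arguments.
Unset Strict Implicit.
Unset Printing Implicit Defensive.

Import Order.TTheory GRing.Theory Num.Theory.
Import numFieldNormedType.Exports.
Local Open Scope classical_set_scope.
Local Open Scope ring_scope.

(** * Taylor bounds for exp and cos *)

Lemma series_exp_coeff_le (R : realType) (x : R) (n : nat) :
  0 <= x -> series (exp_coeff x) n <= expR x.
Proof.
move=> x0; rewrite /expR.
apply: nondecreasing_cvgn_le; last exact: is_cvg_series_exp_coeff.
apply: nondecreasing_series => i _ _; exact: exp_coeff_ge0.
Qed.

(** Beyond index [N] a term is at most [x ^+ N] times [x ^+ i / i!], because [i! <= (i + N)!], and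
    the sum over [i] is at most [expR x]. One crude remainder thus serves both [expR] and [cos]. *)
Lemma exp_majorant_tail (R : realType) (a : R^nat) (x : R) (N : nat) :
  0 <= x -> (forall k, `|a k| <= exp_coeff x k) ->
  `|limn (series a) - \sum_(0 <= k < N) a k| <= x ^+ N * expR x.
Proof.
move=> x0 ale.
have cva : cvgn (series a).
  apply: normed_cvg; apply: (series_le_cvg _ _ ale).
  - by move=> n; exact: normr_ge0.
  - by move=> n; exact: exp_coeff_ge0.
  - exact: is_cvg_series_exp_coeff.
have cvb : `|series a n - \sum_(0 <= k < N) a k| @[n --> \oo] -->
    `|limn (series a) - \sum_(0 <= k < N) a k|.
  by apply: cvg_norm; apply: cvgB => //; exact: cvg_cst.
rewrite -(cvg_lim _ cvb)//; apply: limr_le; first by apply/cvg_ex; eexists; exact: cvb.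
near=> n.
have Nn : (N <= n)%N by near: n; exact: nbhs_infty_ge.
rewrite /series/= (big_cat_nat (leq0n N) Nn)/= addrAC subrr add0r.
apply: (le_trans (ler_norm_sum _ _ _)).
rewrite -{1}(add0n N) big_addn.
apply: (@le_trans _ _ (x ^+ N * series (exp_coeff x) (n - N)%N)); last first.
  by rewrite ler_wpM2l ?exprn_ge0// series_exp_coeff_le.
rewrite /series/= mulr_sumr; apply: ler_sum => i _.
apply: (le_trans (ale _)).
rewrite /exp_coeff/= exprD (mulrC (x ^+ i)) -mulrA.
rewrite ler_wpM2l ?exprn_ge0// ler_wpM2l ?exprn_ge0//.
rewrite lef_pV2 ?posrE ?ltr0n ?fact_gt0// ler_nat.
elim: (N) => [|m IH]; first by rewrite addn0.
by rewrite addnS factS (leq_trans IH)// leq_pmull.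
Unshelve. all: by end_near. Qed.

Lemma expR_taylor (R : realType) (x : R) (N : nat) :
  `|expR x - \sum_(0 <= k < N) x ^+ k / k`!%:R| <= `|x| ^+ N * expR `|x|.
Proof.
apply: (@exp_majorant_tail _ (exp_coeff x)) => // k.
by rewrite /exp_coeff/= normrM normfV normrX (ger0_norm (ler0n _ _)).
Qed.

Lemma cos_taylor (R : realType) (x : R) (N : nat) :
  `|cos x - \sum_(0 <= k < N) cos_coeff x k| <= `|x| ^+ N * expR `|x|.
Proof.
rewrite unlock; apply: exp_majorant_tail => // k.
rewrite /cos_coeff /exp_coeff/= !normrM normfV normrX (ger0_norm (ler0n _ _)).
rewrite normrX normrN1 expr1n (ger0_norm (ler0n _ (k`!))).
rewrite ler_wpM2r ?invr_ge0 ?ler0n//.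
by case: odd => /=; rewrite ?normr0 ?normr1 ?mul0r ?mul1r ?mulr1 ?exprn_ge0.
Qed.

Lemma expR_taylor4 (R : realType) (x : R) :
  `|expR x - (1 + x + x ^+ 2 / 2 + x ^+ 3 / 6)| <= `|x| ^+ 4 * expR `|x|.
Proof.
have := expR_taylor x 4; rewrite !big_nat_recr//= big_geq//= add0r.
by rewrite !factS fact0 expr0 expr1 !muln1 !divr1.
Qed.

Lemma cos_taylor4 (R : realType) (x : R) :
  `|cos x - (1 - x ^+ 2 / 2)| <= `|x| ^+ 4 * expR `|x|.
Proof.
have := cos_taylor x 4; rewrite !big_nat_recr//= big_geq//= add0r.
rewrite /cos_coeff/= !factS fact0 expr0 expr1 !muln1 !divr1 !mul0r !addr0.
by rewrite !mul1r mulN1r mulNr.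
Qed.

(* [(e^(x/2) - e^(-x/2))^6] expanded: it is [x^6 + O(x^7)] at 0 and,
   being a combination of exponentials, has an explicit Gaussian integral. *)
Definition sixth_diff (R : realType) (x : R) : R :=
  expR (3 * x) + expR (- 3 * x) - 6 * (expR (2 * x) + expR (- 2 * x))
  + 15 * (expR x + expR (- 1 * x)) - 20.

(** The signed binomial weights cancel all powers below the sixth. In the remainder, 44 is the sum 2
    * (1 + 6 + 15) of the absolute weights of the exponentials, and [3 ^+ 7] comes from the largest
    scale 3. *)
Lemma sixth_diff_taylor (R : realType) (x : R) :
  `|sixth_diff x - x ^+ 6| <= 44 * 3 ^+ 7 * (`|x| ^+ 7 * expR (3 * `|x|)).
Proof.
have key (a : R) : `|a| <= 3 ->
    `|expR (a * x) - (1 + a * x + (a * x) ^+ 2 / 2 + (a * x) ^+ 3 / 6 +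
      (a * x) ^+ 4 / 24 + (a * x) ^+ 5 / 120 + (a * x) ^+ 6 / 720)|
    <= 3 ^+ 7 * (`|x| ^+ 7 * expR (3 * `|x|)).
  move=> a3; have := expR_taylor (a * x) 7.
  rewrite !big_nat_recr//= big_geq//= add0r.
  rewrite !factS fact0 expr0 expr1 !muln1 !divr1 => /le_trans; apply.
  rewrite normrM exprMn -mulrA; apply: ler_pM; rewrite ?exprn_ge0 ?mulr_ge0 ?exprn_ge0 ?expR_ge0//.
    by rewrite lerXn2r ?nnegrE//.
  by rewrite ler_wpM2l ?exprn_ge0// ler_expR ler_wpM2r.
rewrite -mulrA; set B := 3 ^+ 7 * _ in key *.
pose e (a : R) := expR (a * x) - (1 + a * x + (a * x) ^+ 2 / 2 + (a * x) ^+ 3 / 6 +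
      (a * x) ^+ 4 / 24 + (a * x) ^+ 5 / 120 + (a * x) ^+ 6 / 720).
have -> : sixth_diff x - x ^+ 6 =
    e 3 + e (- 3) - 6 * (e 2 + e (- 2)) + 15 * (e 1 + e (- 1)).
  by rewrite /sixth_diff /e mul1r; field.
have k (a : R) : `|a| <= 3 -> - B <= e a <= B.
  by rewrite -ler_norml; exact: key.
have k1 := k 3; have k2 := k (- 3); have k3 := k 2; have k4 := k (- 2).
have k5 := k 1; have k6 := k (- 1).
rewrite !normrN !ger0_norm// in k1 k2 k3 k4 k5 k6.
have {}k1 : - B <= e 3 <= B by apply: k1; lra.
have {}k2 : - B <= e (- 3) <= B by apply: k2; lra.
have {}k3 : - B <= e 2 <= B by apply: k3; lra.
have {}k4 : - B <= e (- 2) <= B by apply: k4; lra.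
have {}k5 : - B <= e 1 <= B by apply: k5; lra.
have {}k6 : - B <= e (- 1) <= B by apply: k6; lra.
move: (e 3) (e (- 3)) (e 2) (e (- 2)) (e 1) (e (- 1)) k1 k2 k3 k4 k5 k6 => {key k e}.
by move: B => B *; rewrite ler_norml; lra.
Qed.

(** * Scalar limits as the parameter tends to infinity *)

Lemma cvg_sqrtV_bound (R : realType) (F : R -> R) (L C g0 : R) :
  (forall g, g0 <= g -> `|F g - L| <= C / Num.sqrt g) -> F g @[g --> +oo] --> L.
Proof.
move=> FL; apply/cvgrPdist_le => e e0; near=> g.
have g1 : 1 <= g by near: g; apply: nbhs_pinfty_ge; rewrite num_real.
have sg0 : 0 < Num.sqrt g by rewrite sqrtr_gt0; lra.
rewrite distrC; apply: (le_trans (FL g _)); first by near: g; apply: nbhs_pinfty_ge; rewrite num_real.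
(* It suffices that [g] exceeds the square of [C / e]; passing through the absolute value also
   covers a negative [C]. *)
rewrite ler_pdivrMr// -ler_pdivrMl// (le_trans (ler_norm _))// -sqrtr_sqr.
apply: ler_wsqrtr.
by near: g; apply: nbhs_pinfty_ge; rewrite num_real.
Unshelve. all: by end_near. Qed.

(** With [z = |c|^2 / (4 g)], the combination of exponentials is the normalized Gaussian integral of
    [sixth_diff (t . c)]. Orders 0, 1 and 2 cancel, and the cubic coefficient is (2 * 9^3 - 12 * 4^3
    + 30) / 6 = 120; also 44 = 2 + 12 + 30. *)
Lemma sixth_diff_moment_taylor (R : realType) (z : R) : 0 <= z ->
  `|2 * expR (9 * z) - 12 * expR (4 * z) + 30 * expR z - 20 - 120 * z ^+ 3|
  <= 44 * 9 ^+ 4 * (z ^+ 4 * expR (9 * z)).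
Proof.
move=> z0; rewrite -mulrA; set B := 9 ^+ 4 * _.
pose e a := expR (a * z) - (1 + a * z + (a * z) ^+ 2 / 2 + (a * z) ^+ 3 / 6).
have key a : 0 <= a -> a <= 9 -> - B <= e a <= B.
  move=> a0 a9; rewrite -ler_norml; apply: (le_trans (expR_taylor4 _)).
  rewrite ger0_norm ?mulr_ge0// exprMn -mulrA.
  apply: ler_pM; rewrite ?exprn_ge0 ?mulr_ge0 ?exprn_ge0 ?expR_ge0//.
    by rewrite lerXn2r ?nnegrE//; lra.
  by rewrite ler_wpM2l ?exprn_ge0// ler_expR ler_wpM2r.
have := key 9; have := key 4; have := key 1.
rewrite [X in `|X|](_ : _ = 2 * e 9 - 12 * e 4 + 30 * e 1); last first.
  by rewrite /e mul1r; field.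
move: (e 9) (e 4) (e 1); move: B {key} => B *; rewrite ler_norml; lra.
Qed.

Lemma cvg_sixth_diff_moment (R : realType) (q : R) : 0 <= q ->
  g ^+ 3 * (2 * expR (9 * (q / g)) - 12 * expR (4 * (q / g))
            + 30 * expR (q / g) - 20) @[g --> +oo] --> 120 * q ^+ 3.
Proof.
move=> q0; apply: (@cvg_sqrtV_bound _ _ _ (44 * 9 ^+ 4 * (q ^+ 4 * expR (9 * q))) 1).
move=> g g1.
have g0 : 0 < g by lra.
set f := (X in g ^+ 3 * X).
have -> : g ^+ 3 * f - 120 * q ^+ 3 = g ^+ 3 * (f - 120 * (q / g) ^+ 3).
  by field; lra.
rewrite normrM ger0_norm ?exprn_ge0//; last lra.
have := @sixth_diff_moment_taylor R (q / g) (divr_ge0 q0 (ltW g0)).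
rewrite -/f => /(ler_wpM2l (exprn_ge0 3 (ltW g0))) /le_trans; apply.
have -> : g ^+ 3 * (44 * 9 ^+ 4 * ((q / g) ^+ 4 * expR (9 * (q / g)))) =
    44 * 9 ^+ 4 * (q ^+ 4 * expR (9 * (q / g)) / g) by field; lra.
rewrite -[leRHS]mulrA ler_wpM2l ?mulr_ge0 ?exprn_ge0//.
have sg0 : 0 < Num.sqrt g by rewrite sqrtr_gt0.
apply: ler_pM; rewrite ?invr_ge0 ?mulr_ge0 ?exprn_ge0 ?expR_ge0//; first lra.
  rewrite ler_wpM2l ?exprn_ge0// ler_expR ler_wpM2l//.
  by rewrite ler_pdivrMr// ler_peMr.
by rewrite lef_pV2 ?posrE// -[leRHS]sqr_sqrtr ?(ltW g0)// ler_eXnr// -sqrtr1 ler_wsqrtr.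
Qed.

(** * Sample averages and the expansion of their product *)

Section average.
Context (R : realType) (n : nat).
Implicit Type f : 'I_n -> R.

Definition average f : R := n%:R^-1 * \sum_(j < n) f j.

Lemma norm_average_le f (B : R) : 0 <= B -> (forall j, `|f j| <= B) ->
  `|average f| <= B.
Proof.
move=> B0 fB; rewrite /average normrM normfV (ger0_norm (ler0n _ _)).
have [n0|n0] := posnP n; first by rewrite [X in X%:R^-1]n0 invr0 mul0r.
rewrite ler_pdivrMl ?ltr0n//; apply: (le_trans (ler_norm_sum _ _ _)).
apply: (le_trans (ler_sum _ (fun j _ => fB j))).
by rewrite sumr_const card_ord mulr_natl.
Qed.

Lemma averageB f g : average (fun j => f j - g j) = average f - average g.
Proof. by rewrite /average sumrB mulrBr. Qed.

Lemma averageD f g : average (fun j => f j + g j) = average f + average g.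
Proof. by rewrite /average big_split/= mulrDr. Qed.

Lemma averageZr f c : average (fun j => f j * c) = average f * c.
Proof. by rewrite /average -mulr_suml mulrA. Qed.

Lemma average1 : (0 < n)%N -> average (fun=> 1) = 1.
Proof.
move=> n0; rewrite /average sumr_const card_ord mulVf//.
by rewrite pnatr_eq0 -lt0n.
Qed.

End average.

(** Here [x j] stands for [t . Y_j]. The product minus 1 is within [5 y^4 E^2] of [m3 / 6], and the
    sum of these two quantities is at most [6 y^3 E^3], where [E = expR y]; the difference of
    squares is bounded by the product, whence 30. *)
Lemma cos_exp_average_taylor (R : realType) (n : nat) (x : 'I_n -> R) (y : R) :
  (0 < n)%N -> average (fun j => x j) = 0 -> (forall j, `|x j| <= y) ->
  `|(average (fun j => cos (x j)) * average (fun j => expR (x j)) - 1) ^+ 2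
    - (average (fun j => x j ^+ 3) / 6) ^+ 2| <= 30 * (y ^+ 7 * expR (5 * y)).
Proof.
move=> n0 x0 xy.
have y0 : 0 <= y by apply: le_trans (xy (Ordinal n0)).
set A := average _; set M := average (fun j => expR _).
set m3 := average _.
pose m2 := average (fun j => x j ^+ 2).
set E := expR y.
have rem_le j : `|x j| ^+ 4 * expR `|x j| <= y ^+ 4 * E.
  by apply: ler_pM; rewrite ?exprn_ge0 ?expR_ge0 ?ler_expR// lerXn2r ?nnegrE.
have yE0 : 0 <= y ^+ 4 * E by rewrite mulr_ge0 ?exprn_ge0 ?expR_ge0.
have hA : `|A - (1 - m2 / 2)| <= y ^+ 4 * E.
  have -> : 1 - m2 / 2 = average (fun j => 1 - x j ^+ 2 / 2).
    by rewrite averageB averageZr average1.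
  rewrite -averageB; apply: norm_average_le => // j.
  exact: le_trans (cos_taylor4 _) (rem_le j).
have hM : `|M - (1 + m2 / 2 + m3 / 6)| <= y ^+ 4 * E.
  have -> : 1 + m2 / 2 + m3 / 6 =
      average (fun j => 1 + x j + x j ^+ 2 / 2 + x j ^+ 3 / 6).
    by rewrite !averageD !averageZr average1// x0 addr0.
  rewrite -averageB; apply: norm_average_le => // j.
  exact: le_trans (expR_taylor4 _) (rem_le j).
have A1 : `|A| <= 1.
  by apply: norm_average_le => // j; rewrite ler_norml cos_geN1 cos_le1.
have h2 : `|m2| <= y ^+ 2.
  apply: norm_average_le; rewrite ?exprn_ge0// => j.
  by rewrite normrX lerXn2r ?nnegrE.
have h3 : `|m3| <= y ^+ 3.
  apply: norm_average_le; rewrite ?exprn_ge0// => j.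
  by rewrite normrX lerXn2r ?nnegrE.
have E1 : 1 + y <= E by exact: expR_ge1Dx.
have E2 : 1 + y ^+ 2 / 2 <= E by have := @expR_ge1Dxn R y 1 y0.
have E3 : 1 + y ^+ 3 / 6 <= E by have := @expR_ge1Dxn R y 2 y0.
have y2 : 0 <= y ^+ 2 by exact: exprn_ge0.
have y3 : 0 <= y ^+ 3 by exact: exprn_ge0.
have hP : `|1 + m2 / 2 + m3 / 6| <= 3 * E.
  by move: h2 h3; rewrite !ler_norml; lra.
have hr : `|A * M - 1 - m3 / 6| <= 5 * (y ^+ 4 * E ^+ 2).
  (* [M], then [A], is replaced by its Taylor polynomial; the last bracket is what the product of
     the two polynomials leaves besides [1 + m3 / 6]. *)
  rewrite (_ : _ - _ = A * (M - (1 + m2 / 2 + m3 / 6))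
    + (A - (1 - m2 / 2)) * (1 + m2 / 2 + m3 / 6)
    - (m2 * m2 / 4 + m2 * m3 / 12)); last by field.
  have b1 : `|A * (M - (1 + m2 / 2 + m3 / 6))| <= 1 * (y ^+ 4 * E).
    by rewrite normrM ler_pM.
  have b2 : `|(A - (1 - m2 / 2)) * (1 + m2 / 2 + m3 / 6)| <= y ^+ 4 * E * (3 * E).
    by rewrite normrM ler_pM.
  have b3 : `|m2 * m2| <= y ^+ 2 * y ^+ 2 by rewrite normrM ler_pM.
  have b4 : `|m2 * m3| <= y ^+ 2 * y ^+ 3 by rewrite normrM ler_pM.
  rewrite -!exprD/= in b3 b4.
  have b5 : y ^+ 5 <= y ^+ 4 * E by rewrite exprSr ler_wpM2l ?exprn_ge0//; lra.
  have b6 : y ^+ 4 <= y ^+ 4 * E by rewrite ler_peMr ?exprn_ge0//; lra.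
  have b7 : y ^+ 4 * E <= y ^+ 4 * E ^+ 2.
    by rewrite expr2 mulrA ler_peMr//; lra.
  have b8 : y ^+ 4 * E * (3 * E) = 3 * (y ^+ 4 * E ^+ 2) by ring.
  rewrite b8 in b2; rewrite mul1r in b1.
  move: b1 b2 b3 b4 b5 b6 b7; rewrite !ler_norml; lra.
rewrite subr_sqr normrM.
have -> : 30 * (y ^+ 7 * expR (5 * y)) = 5 * (y ^+ 4 * E ^+ 2) * (6 * (y ^+ 3 * E ^+ 3)).
  by rewrite expRM_natl /E; ring.
apply: ler_pM => //.
rewrite (_ : A * M - 1 + m3 / 6 = (A * M - 1 - m3 / 6) + m3 / 3); last by field.
(* The inequality [y <= E] lowers the fourth power to the third, the order of [m3]. *)
have c1 : y ^+ 4 * E ^+ 2 <= y ^+ 3 * E ^+ 3.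
  rewrite exprSr -mulrA ler_wpM2l// [leRHS]exprS ler_wpM2r ?exprn_ge0 ?expR_ge0//; lra.
have c2 : y ^+ 3 <= y ^+ 3 * E ^+ 3 by rewrite ler_peMr// exprn_ege1//; lra.
move: hr h3; rewrite !ler_norml; lra.
Qed.

(** * Gaussian integrals on column vectors *)

Lemma dotvE (R : realType) (d : nat) (u v : 'cV[R]_d) :
  dotv u v = \sum_(i < d) u i ord0 * v i ord0.
Proof. by rewrite /dotv mxE; apply: eq_bigr => i _; rewrite mxE. Qed.

Lemma dotvv_ge0 (R : realType) (d : nat) (u : 'cV[R]_d) : 0 <= dotv u u.
Proof. by rewrite dotvE sumr_ge0// => i _; rewrite -expr2 sqr_ge0. Qed.

Lemma enorm_sqr (R : realType) (d : nat) (u : 'cV[R]_d) :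
  enorm u ^+ 2 = dotv u u.
Proof. by rewrite /enorm sqr_sqrtr// dotvv_ge0. Qed.

Lemma dotvC (R : realType) (d : nat) (u v : 'cV[R]_d) : dotv u v = dotv v u.
Proof. by rewrite !dotvE; apply: eq_bigr => i _; rewrite mulrC. Qed.

Lemma dotvDr (R : realType) (d : nat) (u v w : 'cV[R]_d) :
  dotv u (v + w) = dotv u v + dotv u w.
Proof. by rewrite /dotv mulmxDr mxE. Qed.

Lemma dotvZr (R : realType) (d : nat) (u v : 'cV[R]_d) (a : R) :
  dotv u (a *: v) = a * dotv u v.
Proof. by rewrite /dotv -scalemxAr mxE. Qed.

Lemma dotvDl (R : realType) (d : nat) (u v w : 'cV[R]_d) :
  dotv (v + w) u = dotv v u + dotv w u.
Proof. by rewrite dotvC dotvDr !(dotvC u). Qed.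

Lemma dotvZl (R : realType) (d : nat) (u v : 'cV[R]_d) (a : R) :
  dotv (a *: v) u = a * dotv v u.
Proof. by rewrite dotvC dotvZr (dotvC u). Qed.

Lemma dotv_vuncons (R : realType) (d : nat) (u v : 'cV[R]_d.+1) :
  dotv u v = (vuncons u).1 * (vuncons v).1 + dotv (vuncons u).2 (vuncons v).2.
Proof.
rewrite !dotvE big_ord_recl; congr (_ + _); apply: eq_bigr => i _.
by rewrite !mxE; congr (u _ _ * v _ _); exact: val_inj.
Qed.

Lemma measurable_dotv (R : realType) (d : nat) (u : 'cV[R]_d) :
  measurable_fun setT (fun t : 'cV[R]_d => dotv t u).
Proof.
under eq_fun do rewrite dotvE.
apply: measurable_sum => i; apply: measurable_funM; last exact: measurable_cst.
exact: measurable_coord.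
Qed.

Lemma measurable_dotvv (R : realType) (d : nat) :
  measurable_fun setT (fun t : 'cV[R]_d => dotv t t).
Proof.
under eq_fun do rewrite dotvE.
by apply: measurable_sum => i; apply: measurable_funM; exact: measurable_coord.
Qed.

(** By completing the square, the integrand is a constant multiple of the normal density with mean
    [u / (2 * g)] and variance [1 / (2 * g)]. *)
Lemma integral_expR_quadratic (R : realType) (u g : R) : 0 < g ->
  (\int[lebesgue_measure]_x (expR (x * u - g * (x * x)))%:E =
   (Num.sqrt (pi / g) * expR (u ^+ 2 / (4 * g)))%:E)%E.
Proof.
move=> g0; pose s := Num.sqrt (2 * g)^-1; pose m := u / (2 * g).
have s2 : s ^+ 2 *+ 2 = g^-1.
  by rewrite /s sqr_sqrtr ?invr_ge0 ?mulr_ge0 ?ltW// -mulr_natr invfM; field; lra.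
have s0 : s != 0 by rewrite sqrtr_eq0 -ltNge invr_gt0 mulr_gt0.
have pE : normal_peak s = (Num.sqrt (pi / g))^-1.
  by rewrite /normal_peak -mulrnAl s2 mulrC.
have sq0 : 0 < Num.sqrt (pi / g) by rewrite sqrtr_gt0 divr_gt0// pi_gt0.
transitivity (\int[lebesgue_measure]_x
  ((Num.sqrt (pi / g) * expR (u ^+ 2 / (4 * g)))%:E * (normal_pdf m s x)%:E))%E.
  apply: eq_integral => x _; rewrite -EFinM; congr EFin.
  rewrite normal_pdfE// pE /normal_fun s2 invrK.
  rewrite mulrACA divff ?gt_eqF// mul1r -expRD; congr expR.
  by rewrite /m; field; lra.
rewrite ge0_integralZl//=.
- by rewrite integral_normal_pdf mule1.
- by apply/measurable_EFinP; exact: measurable_normal_pdf.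
- by move=> x _; rewrite lee_fin normal_pdf_ge0.
Qed.

(** Induction on the dimension by Tonelli: the measure is built one coordinate at a time, and the
    integrand splits into a factor in the first coordinate and one in the others. In dimension 0 the
    measure is a Dirac mass. *)
Lemma integral_expR_dotv (R : realType) (d : nat) (u : 'cV[R]_d) (g : R) :
  0 < g ->
  (\int[lebesgue_cV R d]_t (expR (dotv t u - g * dotv t t))%:E =
   (Num.sqrt (pi / g) ^+ d * expR (dotv u u / (4 * g)))%:E)%E.
Proof.
move=> g0; elim: d u => [|d IH] u.
  rewrite integral_dirac//=.
    by rewrite diracE in_setT mul1e !dotvE !big_ord0 mulr0 subrr mul0r expR0 mulr1.
  apply/measurable_EFinP; apply: measurableT_comp => //.
  apply: measurable_funB; first exact: measurable_dotv.
  by apply: measurable_funM => //; exact: measurable_dotvv.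
have mf : measurable_fun setT (fun t : 'cV[R]_d.+1 =>
    (expR (dotv t u - g * dotv t t))%:E).
  apply/measurable_EFinP; apply: measurableT_comp => //.
  apply: measurable_funB; first exact: measurable_dotv.
  by apply: measurable_funM => //; exact: measurable_dotvv.
rewrite [LHS](_ : _ = \int[pushforward (lebesgue_measure \x lebesgue_cV R d)%E (@vcons R d)]_t
   (expR (dotv t u - g * dotv t t))%:E)%E//.
rewrite ge0_integral_pushforward//=; last exact: measurable_vcons.
have mfv : measurable_fun setT (fun p : measurableTypeR R * 'cV[R]_d =>
    (expR (dotv (vcons p) u - g * dotv (vcons p) (vcons p)))%:E).
  exact: (measurableT_comp mf (@measurable_vcons R d)).
rewrite preimage_setT fubini_tonelli1//=.
transitivity (\int[lebesgue_measure]_x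
    ((Num.sqrt (pi / g) ^+ d * expR (dotv (vuncons u).2 (vuncons u).2 / (4 * g)))%:E *
     (expR (x * (vuncons u).1 - g * (x * x)))%:E))%E.
  apply: eq_integral => x _; rewrite /fubini_F.
  under eq_integral => v _.
    rewrite !dotv_vuncons vconsK/=.
    rewrite mulrDr opprD addrACA expRD EFinM.
    over.
  rewrite ge0_integralZl//=; first by rewrite IH muleC.
    apply/measurable_EFinP; apply: measurableT_comp => //.
    apply: measurable_funB; first exact: measurable_dotv.
    by apply: measurable_funM => //; exact: measurable_dotvv.
rewrite ge0_integralZl//=.
- rewrite integral_expR_quadratic// -EFinM; congr EFin.
  rewrite mulrACA -exprSr -expRD; congr (_ * expR _).
  rewrite -mulrDl addrC; congr (_ / _).
  by rewrite dotv_vuncons expr2.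
- apply/measurable_EFinP; apply: measurableT_comp => //.
  apply: measurable_funB; first exact: measurable_funM.
  by apply: measurable_funM => //; exact: measurable_funM.
Qed.

Lemma enorm_ge0 (R : realType) (d : nat) (u : 'cV[R]_d) : 0 <= enorm u.
Proof. exact: sqrtr_ge0. Qed.

(** Each coordinate of [t] is at most [enorm t]. The constant need not be sharp, since only the
    growth in [t] matters later. *)
Lemma norm_dotv_le (R : realType) (d : nat) (t u : 'cV[R]_d) :
  `|dotv t u| <= enorm t * \sum_(i < d) `|u i ord0|.
Proof.
rewrite dotvE (le_trans (ler_norm_sum _ _ _))// mulr_sumr.
apply: ler_sum => i _; rewrite normrM ler_wpM2r//.
rewrite -sqrtr_sqr ler_wsqrtr// dotvE (bigD1 i)//= -expr2 lerDl.
by rewrite sumr_ge0// => j _; rewrite -expr2 sqr_ge0.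
Qed.

Lemma measurable_enorm (R : realType) (d : nat) :
  measurable_fun setT (@enorm R d).
Proof.
apply: (measurableT_comp _ (@measurable_dotvv R d)).
apply: continuous_measurable_fun; exact: sqrt_continuous.
Qed.

Lemma measurable_weight (R : realType) (d : nat) (g : R) :
  measurable_fun setT (@weight R d g).
Proof.
apply: measurableT_comp => //; apply: measurable_funM => //.
by apply: measurable_funX; exact: measurable_enorm.
Qed.

(** Integrability travels with the value, so that linear combinations of known integrals can be
    formed without separate side conditions. *)
Definition has_gauss_integral (R : realType) (d : nat) (g : R)
    (f : 'cV[R]_d -> R) (v : R) : Prop :=
  (lebesgue_cV R d).-integrable setT (fun t => (f t * weight g t)%:E) /\
  \int[lebesgue_cV R d]_t (f t * weight g t) = v.

Section gauss_integral.
Context (R : realType) (d : nat) (g : R).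
Implicit Types f h : 'cV[R]_d -> R.

Lemma has_gauss_integral_expR (u : 'cV[R]_d) : 0 < g ->
  has_gauss_integral g (fun t => expR (dotv t u))
    (Num.sqrt (pi / g) ^+ d * expR (dotv u u / (4 * g))).
Proof.
move=> g0.
have eqf t : expR (dotv t u) * weight g t = expR (dotv t u - g * dotv t t).
  by rewrite /weight -expRD enorm_sqr mulNr.
have intf : (\int[lebesgue_cV R d]_t (expR (dotv t u) * weight g t)%:E =
   (Num.sqrt (pi / g) ^+ d * expR (dotv u u / (4 * g)))%:E)%E.
  by rewrite -integral_expR_dotv//; apply: eq_integral => t _; rewrite eqf.
split; last by rewrite /Rintegral intf.
apply/integrableP; split.
  apply/measurable_EFinP; apply: measurable_funM; last exact: measurable_weight.
  by apply: measurableT_comp => //; exact: measurable_dotv.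
under eq_integral do rewrite /= ger0_norm ?mulr_ge0 ?expR_ge0//.
by rewrite intf ltry.
Qed.

Lemma has_gauss_integralD f h (v w : R) :
  has_gauss_integral g f v -> has_gauss_integral g h w ->
  has_gauss_integral g (fun t => f t + h t) (v + w).
Proof.
move=> [intf <-] [inth <-]; split.
  apply: eq_integrable (integrableD measurableT intf inth) => // t _ /=.
  by rewrite -EFinD mulrDl.
rewrite -RintegralD//; apply: eq_Rintegral => t _; exact: mulrDl.
Qed.

Lemma has_gauss_integralZ f (a v : R) :
  has_gauss_integral g f v -> has_gauss_integral g (fun t => a * f t) (a * v).
Proof.
move=> [intf <-]; split.
  apply: eq_integrable (integrableZl measurableT a intf) => // t _ /=.
  by rewrite -EFinM mulrA.
rewrite -RintegralZl//; apply: eq_Rintegral => t _; exact/esym/mulrA.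
Qed.

Lemma has_gauss_integral_eq f h (v w : R) : f =1 h -> v = w ->
  has_gauss_integral g f v -> has_gauss_integral g h w.
Proof. by move=> /funext -> ->. Qed.

Lemma has_gauss_integral_sixth_diff (c : 'cV[R]_d) : 0 < g ->
  has_gauss_integral g (fun t => sixth_diff (dotv t c))
    (Num.sqrt (pi / g) ^+ d *
     (2 * expR (9 * (dotv c c / 4 / g)) - 12 * expR (4 * (dotv c c / 4 / g))
      + 30 * expR (dotv c c / 4 / g) - 20)).
Proof.
move=> g0.
have E a := has_gauss_integral_expR (a *: c) g0.
have := E 3; have := E (- 3); have := E 2; have := E (- 2); have := E 1.
(* The constant term -20 is integrated as a multiple of the exponential for the zero vector. *)
have := E (- 1); have := has_gauss_integralZ (- 20) (E 0).
move=> h0 hN1 h1 hN2 h2 hN3 h3.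
have := has_gauss_integralD (has_gauss_integralD (has_gauss_integralD
  (has_gauss_integralD h3 hN3)
  (has_gauss_integralZ (- 6) (has_gauss_integralD h2 hN2)))
  (has_gauss_integralZ 15 (has_gauss_integralD h1 hN1))) h0.
apply: has_gauss_integral_eq.
  move=> t; rewrite !dotvZr mul0r expR0 mul1r /sixth_diff; ring.
have A a : dotv (a *: c) (a *: c) / (4 * g) = a ^+ 2 * (dotv c c / 4 / g).
  by rewrite dotvZr dotvZl; field; lra.
rewrite !A !sqrrN [0 ^+ 2]expr0n/= mul0r expR0 expr1n !mul1r.
rewrite (_ : 3 ^+ 2 = 9 :> R); last by ring.
rewrite (_ : 2 ^+ 2 = 4 :> R); last by ring.
by ring.
Qed.

End gauss_integral.

(** With [y = e * sqrt g / 2], the bound [y ^+ 7 <= 7! * expR y] trades the seven powers of [e] for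
    [g^(-7/2)]. Then [y <= g e^2 / 4 + 1 / 4] and [K e <= K^2 + g e^2 / 4] use up half of the
    Gaussian exponent. *)
Lemma expr7_expR_gauss_le (R : realType) (e K g : R) :
  0 <= e -> 1 <= g ->
  e ^+ 7 * expR (K * e) * expR (- g * e ^+ 2) <=
  2 ^+ 7 * 7`!%:R * expR (1 + K ^+ 2) / Num.sqrt g ^+ 7
  * expR (- (g / 2) * e ^+ 2).
Proof.
move=> e0 g1; have sg0 : 0 < Num.sqrt g by rewrite sqrtr_gt0; lra.
have sg2 : Num.sqrt g ^+ 2 = g by rewrite sqr_sqrtr//; lra.
move: (Num.sqrt g) sg0 sg2 => s sg0 sg2; pose y := e * s / 2.
have y0 : 0 <= y by rewrite !mulr_ge0// ltW.
have -> : e ^+ 7 = 2 ^+ 7 * y ^+ 7 / s ^+ 7.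
  by rewrite /y; field; rewrite gt_eqF.
have h : y ^+ 7 <= 7`!%:R * expR y.
  rewrite -ler_pdivrMl ?ltr0n ?fact_gt0// mulrC.
  by have := @expR_ge1Dxn R y 6 y0; apply: le_trans; rewrite lerDr.
move: (7`!%:R) (ler0n R (7`!)) h => F F0 h.
rewrite [leLHS](_ : _ = 2 ^+ 7 / s ^+ 7 * (y ^+ 7 * expR (K * e + - g * e ^+ 2))); last first.
  by rewrite expRD; ring.
rewrite [leRHS](_ : _ = 2 ^+ 7 / s ^+ 7 *
    (F * (expR (1 + K ^+ 2) * expR (- (g / 2) * e ^+ 2)))); last by ring.
rewrite ler_wpM2l ?divr_ge0 ?exprn_ge0 ?(ltW sg0)//.
apply: (@le_trans _ _ (F * expR y * expR (K * e + - g * e ^+ 2))).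
  by rewrite ler_wpM2r ?expR_ge0.
rewrite -!mulrA ler_wpM2l// -!expRD ler_expR.
have := sqr_ge0 (y - 1 / 2); have := sqr_ge0 (K - e / 2).
have -> : (y - 1 / 2) ^+ 2 = e ^+ 2 * g / 4 - y + 1 / 4.
  by rewrite -sg2 /y; field.
have e2g : e ^+ 2 <= g * e ^+ 2 by rewrite ler_peMl ?exprn_ge0.
rewrite sqrrB; lra.
Qed.

(** The integrand is dominated by a multiple of the weight with parameter [g / 2]. Counting powers,
    [g^3 g^(d/2)] against [g^(-7/2) g^(-d/2)] leaves [g^(-1/2)]. *)
Lemma gauss_integral_error (R : realType) (d : nat) (f : 'cV[R]_d -> R)
    (C K g : R) :
  measurable_fun setT f -> 0 <= C ->
  (forall t, `|f t| <= C * (enorm t ^+ 7 * expR (K * enorm t))) -> 1 <= g ->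
  exists2 v, has_gauss_integral g f v &
    `|g ^+ 3 * Num.sqrt g ^+ d * v| <=
    C * (2 ^+ 7 * 7`!%:R * expR (1 + K ^+ 2)) * Num.sqrt (2 * pi) ^+ d
    / Num.sqrt g.
Proof.
move=> mf C0 fC g1; have g0 : 0 < g by lra.
have g20 : 0 < g / 2 by lra.
set M := 2 ^+ 7 * _ * _.
(* The dominating constant carries the factor [expR (dotv t 0)], so that its integral is an instance
   of the exponential one. *)
have [intw Iw] := has_gauss_integralZ (C * (M / Num.sqrt g ^+ 7))
  (has_gauss_integral_expR (0 : 'cV[R]_d) g20).
pose h (t : 'cV[R]_d) := C * (M / Num.sqrt g ^+ 7) * expR (dotv t 0).
rewrite -/h in intw Iw.
have M0 : 0 <= M by rewrite !mulr_ge0 ?exprn_ge0 ?expR_ge0.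
have sg0 : 0 < Num.sqrt g by rewrite sqrtr_gt0.
have h0 t : 0 <= h t.
  by rewrite /h !mulr_ge0 ?invr_ge0 ?exprn_ge0 ?expR_ge0 ?sqrtr_ge0.
have fh t : `|f t * weight g t| <= h t * weight (g / 2) t.
  rewrite normrM (ger0_norm (expR_ge0 _)) /h.
  rewrite dotvE big1 ?expR0 ?mulr1; last by move=> i _; rewrite mxE mulr0.
  apply: (@le_trans _ _ (C * (enorm t ^+ 7 * expR (K * enorm t)) * weight g t)).
    by rewrite ler_wpM2r ?expR_ge0.
  rewrite -mulrA -[leRHS]mulrA ler_wpM2l//.
  exact: expr7_expR_gauss_le (enorm_ge0 t) g1.
have intf : (lebesgue_cV R d).-integrable setT
    (fun t => (f t * weight g t)%:E).
  apply: (le_integrable measurableT _ _ intw).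
    by apply/measurable_EFinP; apply: measurable_funM => //; exact: measurable_weight.
  move=> t _ /=; rewrite lee_fin (le_trans (fh t))//.
  exact: ler_norm.
exists (\int[lebesgue_cV R d]_t (f t * weight g t)) => //.
rewrite normrM ger0_norm ?mulr_ge0 ?exprn_ge0 ?(ltW g0) ?(ltW sg0)//.
apply: (@le_trans _ _ (g ^+ 3 * Num.sqrt g ^+ d *
    \int[lebesgue_cV R d]_t (h t * weight (g / 2) t))).
  rewrite ler_wpM2l ?mulr_ge0 ?exprn_ge0 ?(ltW g0) ?(ltW sg0)//.
  apply: (le_trans (le_normr_Rintegral _ _)) => //.
  apply: le_Rintegral => //; first exact: integrable_norm.
rewrite Iw dotvE big1 ?mul0r ?expR0 ?mulr1; last by move=> i _; rewrite mxE mulr0.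
have -> : Num.sqrt (pi / (g / 2)) = Num.sqrt (2 * pi) / Num.sqrt g.
  rewrite -sqrtrV ?(ltW g0)// -sqrtrM ?mulr_ge0 ?pi_ge0//; congr Num.sqrt.
  by field; lra.
rewrite exprMn exprVn -{1}(sqr_sqrtr (ltW g0)).
rewrite le_eqVlt; apply/orP; left; apply/eqP; field.
by rewrite expf_neq0 gt_eqF.
Qed.

(** * Normalized limits of Gaussian integrals *)

(* The factor is [g^(3 + d/2)]: six powers of t count for [g^-3]. *)
Definition laplace_limit (R : realType) (d : nat) (f : 'cV[R]_d -> R) (L : R) :=
  exists2 I : R -> R, (forall g, 1 <= g -> has_gauss_integral g f (I g)) &
    g ^+ 3 * Num.sqrt g ^+ d * I g @[g --> +oo] --> L.

Section laplace_limit.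
Context (R : realType) (d : nat).
Implicit Types (f h : 'cV[R]_d -> R) (a b c : 'cV[R]_d).

Lemma laplace_limit_eq f h (L M : R) : f =1 h -> L = M ->
  laplace_limit f L -> laplace_limit h M.
Proof. by move=> /funext -> ->. Qed.

Lemma laplace_limitD f h (L M : R) : laplace_limit f L -> laplace_limit h M ->
  laplace_limit (fun t => f t + h t) (L + M).
Proof.
move=> [I HI LI] [J HJ LJ]; exists (fun g => I g + J g).
  by move=> g g1; apply: has_gauss_integralD; [exact: HI|exact: HJ].
under eq_fun do rewrite mulrDr.
exact: cvgD.
Qed.

Lemma laplace_limitZ f (k L : R) : laplace_limit f L ->
  laplace_limit (fun t => k * f t) (k * L).
Proof.
move=> [I HI LI]; exists (fun g => k * I g).
  by move=> g g1; apply: has_gauss_integralZ; exact: HI.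
under eq_fun do rewrite mulrCA.
by apply: cvgM => //; exact: cvg_cst.
Qed.

Lemma laplace_limit_error f (C K : R) : measurable_fun setT f -> 0 <= C ->
  (forall t, `|f t| <= C * (enorm t ^+ 7 * expR (K * enorm t))) ->
  laplace_limit f 0.
Proof.
move=> mf C0 fC; exists (fun g => \int[lebesgue_cV R d]_t (f t * weight g t)).
  by move=> g /(gauss_integral_error mf C0 fC)[v [intf _] _].
apply: (@cvg_sqrtV_bound _ _ _
  (C * (2 ^+ 7 * 7`!%:R * expR (1 + K ^+ 2)) * Num.sqrt (2 * pi) ^+ d) 1) => g g1.
rewrite subr0.
by have [v [_ ->]] := gauss_integral_error mf C0 fC g1.
Qed.

Lemma laplace_limit_sum (I : Type) (s : seq I) (f : I -> 'cV[R]_d -> R) (L : I -> R) :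
  (forall i, laplace_limit (f i) (L i)) ->
  laplace_limit (fun t => \sum_(i <- s) f i t) (\sum_(i <- s) L i).
Proof.
move=> fL; elim: s => [|i s IH].
  apply: (@laplace_limit_eq (cst 0) _ 0); [by move=> t; rewrite big_nil|by rewrite big_nil|].
  (* The empty sum is the zero function, an error term with both constants 0. *)
  apply: (@laplace_limit_error _ 0 0) => //.
  by move=> t; rewrite normr0 mul0r.
rewrite big_cons; apply: laplace_limit_eq (laplace_limitD (fL i) IH) => // t.
by rewrite big_cons.
Qed.

Lemma measurable_sixth_diff :
  measurable_fun setT (@sixth_diff R).
Proof.
apply: measurable_funB => //; apply: measurable_funD.
  apply: measurable_funB; first apply: measurable_funD.
  - by apply: measurableT_comp => //; exact: measurable_funM.
  - by apply: measurableT_comp => //; exact: measurable_funM.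
  - apply: measurable_funM => //; apply: measurable_funD.
      by apply: measurableT_comp => //; exact: measurable_funM.
    by apply: measurableT_comp => //; exact: measurable_funM.
apply: measurable_funM => //; apply: measurable_funD => //.
by apply: measurableT_comp => //; exact: measurable_funM.
Qed.

(** The factor [sqrt (pi / g) ^+ d] cancels the normalization up to [sqrt pi ^+ d]; the scalar limit
    at [q = |c|^2 / 4] remains. *)
Lemma laplace_limit_sixth_diff c :
  laplace_limit (fun t => sixth_diff (dotv t c))
    (Num.sqrt pi ^+ d * (120 * (dotv c c / 4) ^+ 3)).
Proof.
eexists; first by move=> g g1; apply: has_gauss_integral_sixth_diff; lra.
have q0 : 0 <= dotv c c / 4 by rewrite divr_ge0 ?dotvv_ge0.
apply: cvg_trans (cvgM (cvg_cst (Num.sqrt pi ^+ d)) (cvg_sixth_diff_moment q0)).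
apply: near_eq_cvg; near=> g.
have g0 : 0 < g by near: g; apply: nbhs_pinfty_gt; rewrite num_real.
have sg0 : 0 < Num.sqrt g by rewrite sqrtr_gt0.
have -> : Num.sqrt (pi / g) = Num.sqrt pi / Num.sqrt g.
  by rewrite -sqrtrV ?(ltW g0)// -sqrtrM ?pi_ge0.
rewrite /= exprMn exprVn.
move: (_ - 20) => X; field.
by rewrite expf_neq0// lt0r_neq0.
Unshelve. all: by end_near. Qed.

(** The sixth power differs from [sixth_diff] by an error of order seven, whose limit is 0; the
    constant is 15 / 8 = 120 / 4^3. *)
Lemma laplace_limit_dotv6 c :
  laplace_limit (fun t => dotv t c ^+ 6)
    (Num.sqrt pi ^+ d * (15 / 8 * dotv c c ^+ 3)).
Proof.
set K := \sum_(i < d) `|c i ord0|.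
have K0 : 0 <= K by apply: sumr_ge0.
have err : laplace_limit (fun t => sixth_diff (dotv t c) - dotv t c ^+ 6) 0.
  apply: (@laplace_limit_error _ (44 * 3 ^+ 7 * K ^+ 7) (3 * K)).
  - apply: measurable_funB.
      by apply: measurableT_comp; [exact: measurable_sixth_diff|exact: measurable_dotv].
    by apply: measurable_funX; exact: measurable_dotv.
  - by rewrite !mulr_ge0 ?exprn_ge0.
  - move=> t; apply: (le_trans (sixth_diff_taylor _)).
    rewrite -[leRHS]mulrA ler_wpM2l ?mulr_ge0 ?exprn_ge0//.
    rewrite mulrA -exprMn; apply: ler_pM; rewrite ?exprn_ge0 ?expR_ge0//.
      rewrite lerXn2r ?nnegrE ?mulr_ge0 ?enorm_ge0// mulrC; exact: norm_dotv_le.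
    rewrite ler_expR -mulrA ler_wpM2l// mulrC; exact: norm_dotv_le.
apply: laplace_limit_eq (laplace_limitD (laplace_limit_sixth_diff c) (laplace_limitZ (- 1) err)).
  by move=> t; ring.
by field.
Qed.

(** The value is the Wick count for covariance half the identity: 6 pairings match every [a] with a
    [b], 9 match just one [a] with a [b], and three factors 1/2 give the 8. *)
Lemma laplace_limit_dotv33 a b :
  laplace_limit (fun t => dotv t a ^+ 3 * dotv t b ^+ 3)
    (Num.sqrt pi ^+ d *
     ((6 * dotv a b ^+ 3 + 9 * (dotv a b * dotv a a * dotv b b)) / 8)).
Proof.
(* With A(k, l) = (k x + l y)^6 - (k x - l y)^6, one has
   720 x^3 y^3 = 34 A(1, 1) - A(1, 2) - A(2, 1). *)
pose F k l := laplace_limit_dotv6 (k *: a + l *: b).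
have pm k l := laplace_limitD (F k l) (laplace_limitZ (- 1) (F k (- l))).
have := laplace_limitD (laplace_limitZ (34 / 720) (pm 1 1))
  (laplace_limitZ (- 1 / 720) (laplace_limitD (pm 1 2) (pm 2 1))).
apply: laplace_limit_eq => [t|].
  by rewrite !dotvDr !dotvZr; field.
by rewrite !(dotvDr, dotvDl, dotvZr, dotvZl) (dotvC b a); field.
Qed.

End laplace_limit.

(** * The limit for the sample statistic *)

Lemma sum_sub_sample_mean (R : realType) (d n : nat) (x : 'I_n -> 'cV[R]_d) :
  (0 < n)%N -> \sum_(j < n) (x j - sample_mean x) = 0.
Proof.
move=> n0; rewrite sumrB sumr_const card_ord /sample_mean -scaler_nat scalerA.
by rewrite divff ?scale1r ?subrr// pnatr_eq0 -lt0n.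
Qed.

Lemma sum_scaled_residual (R : realType) (d n : nat) (x : 'I_n -> 'cV[R]_d) :
  (0 < n)%N -> \sum_(j < n) scaled_residual x j = 0.
Proof. by move=> n0; rewrite -mulmx_sumr sum_sub_sample_mean// mulmx0. Qed.

(** The main term [(m3 / 6)^2] is a double sum over pairs of residuals divided by [36 n^2], so the
    pair limits give [(6 b1 + 9 b1_tilde) / (8 * 36)]. *)
Lemma laplace_limit_RnMn (R : realType) (d n : nat) (x : 'I_n -> 'cV[R]_d) :
  (0 < n)%N ->
  laplace_limit (fun t => (Rn x t * Mn x t - 1) ^+ 2)
    (Num.sqrt pi ^+ d * ((2 * b1 x + 3 * b1_tilde x) / 96)).
Proof.
move=> n0; set Y := scaled_residual x.
pose m3 t := average (fun j => dotv t (Y j) ^+ 3).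
have main : laplace_limit (fun t => (m3 t / 6) ^+ 2)
    (Num.sqrt pi ^+ d * ((2 * b1 x + 3 * b1_tilde x) / 96)).
  have := laplace_limitZ ((n%:R ^+ 2)^-1 / 36) (laplace_limit_sum (index_enum 'I_n)
    (fun j => laplace_limit_sum (index_enum 'I_n)
    (fun k => laplace_limit_dotv33 (Y j) (Y k)))).
  apply: laplace_limit_eq => [t|].
    rewrite /m3 /average expr_div_n exprMn exprVn.
    under eq_bigr do rewrite -mulr_sumr.
    rewrite -mulr_suml expr2 [X in _ = _ / X](_ : _ = 36); last by ring.
    by rewrite mulrAC.
  rewrite /b1 /b1_tilde -/Y.
  under eq_bigr do rewrite -mulr_sumr -mulr_suml big_split/= -!mulr_sumr.
  rewrite -mulr_sumr -mulr_suml big_split/= -!mulr_sumr.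
  under [X in _ = _ * ((_ + 3 * (_ * X)) / _)]eq_bigr do
    under eq_bigr do rewrite !enorm_sqr.
  by field; rewrite pnatr_eq0 -lt0n.
(* [S] dominates the l1 norm of every residual, so [enorm t * S] is the uniform bound required by
   [cos_exp_average_taylor]. *)
set S := \sum_(j < n) \sum_(i < d) `|Y j i ord0|.
have S0 : 0 <= S by apply: sumr_ge0 => j _; apply: sumr_ge0.
have YS t j : `|dotv t (Y j)| <= enorm t * S.
  apply: (le_trans (norm_dotv_le _ _)); rewrite ler_wpM2l ?enorm_ge0//.
  rewrite /S (bigD1 j)//= lerDl; apply: sumr_ge0 => k _; exact: sumr_ge0.
have mY j := measurable_dotv (Y j).
have err : laplace_limit (fun t => (Rn x t * Mn x t - 1) ^+ 2 - (m3 t / 6) ^+ 2) 0.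
  apply: (@laplace_limit_error _ _ _ (30 * S ^+ 7) (5 * S)).
  - apply: measurable_funB; apply: measurable_funX.
      apply: measurable_funB => //; apply: measurable_funM.
        apply: measurable_funM => //; apply: measurable_sum => j.
        apply: (measurableT_comp _ (mY j)); apply: continuous_measurable_fun.
        exact: continuous_cos.
      apply: measurable_funM => //; apply: measurable_sum => j.
      exact: (measurableT_comp _ (mY j)).
    apply: measurable_funM => //; apply: measurable_funM => //.
    by apply: measurable_sum => j; exact: measurable_funX.
  - by rewrite mulr_ge0 ?exprn_ge0.
  - move=> t; have Y0 : average (fun j => dotv t (Y j)) = 0.
      rewrite /average; suff -> : \sum_(j < n) dotv t (Y j) = 0 by rewrite mulr0.
      transitivity (dotv t (\sum_(j < n) Y j)).
        by rewrite /dotv mulmx_sumr summxE.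
      by rewrite sum_scaled_residual// /dotv mulmx0 mxE.
    apply: (le_trans (cos_exp_average_taylor n0 Y0 (YS t))).
    rewrite exprMn (mulrC (enorm t ^+ 7)) (mulrC (enorm t)) !mulrA.
    by rewrite le_eqVlt eqxx.
apply: laplace_limit_eq (laplace_limitD main err) => [t|]; last by rewrite addr0.
by rewrite addrC subrK.
Qed.

Lemma cvg_Tn (R : realType) (d n : nat) (x : 'I_n -> 'cV[R]_d) : (0 < n)%N ->
  g `^ (3 + d%:R / 2) * (96 * Tn x g / (n%:R * pi `^ (d%:R / 2))) @[g --> +oo]
    --> 2 * b1 x + 3 * b1_tilde x.
Proof.
move=> n0; have [I HI LI] := laplace_limit_RnMn x n0.
(* Real powers with exponent [d / 2] become natural powers of the square root, the form used in
   [laplace_limit]. *)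
have powd (r : R) : 0 <= r -> r `^ (d%:R / 2) = Num.sqrt r ^+ d.
  by move=> r0; rewrite mulrC powRrM powR12_sqrt// powR_mulrn ?sqrtr_ge0.
have pid : Num.sqrt pi ^+ d != 0 :> R by rewrite expf_neq0// sqrtr_eq0 -ltNge pi_gt0.
have nn0 : n%:R != 0 :> R by rewrite pnatr_eq0 -lt0n.
rewrite [X in _ --> X](_ : _ = 96 / Num.sqrt pi ^+ d *
  (Num.sqrt pi ^+ d * ((2 * b1 x + 3 * b1_tilde x) / 96))); last by field.
apply: cvg_trans (cvgM (cvg_cst (96 / Num.sqrt pi ^+ d)) LI).
apply: near_eq_cvg; near=> g.
have g1 : 1 <= g by near: g; apply: nbhs_pinfty_ge; rewrite num_real.
have g0 : 0 <= g by lra.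
have [intI eqI] := has_gauss_integralZ n%:R (HI g g1).
have -> : Tn x g = n%:R * I g.
  rewrite -eqI; apply: eq_Rintegral => t _.
  by rewrite /Un exprMn sqr_sqrtr.
rewrite powRD; last by apply/implyP => _; rewrite gt_eqF//; lra.
rewrite !powd ?pi_ge0// powR_mulrn//=.
by field; rewrite pid nn0.
Unshelve. all: by end_near. Qed.

(** * Almost sure invertibility of the sample covariance *)

Lemma dotvv_eq0 (R : realType) (d : nat) (u : 'cV[R]_d) :
  (dotv u u == 0) = (u == 0).
Proof.
rewrite dotvE psumr_eq0; last by move=> i _; rewrite -expr2 sqr_ge0.
apply/allP/eqP => [h|-> i _]; last by rewrite /= mxE mulr0.
apply/matrixP => i j; rewrite ord1 [RHS]mxE; apply/eqP.
by have := h i (mem_index_enum i); rewrite /= mulf_eq0 orbb.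
Qed.

Lemma measurable_hyperplane (R : realType) (d : nat) (c : R) (v : 'cV[R]_d) :
  measurable [set x : 'cV[R]_d | dotv x v + c = 0].
Proof.
rewrite [X in measurable X](_ : _ = (fun x => dotv x v + c) @^-1` [set 0]) //.
rewrite -[X in measurable X]setTI.
apply: (measurable_funD (measurable_dotv v) (measurable_cst c)) => //.
Qed.

(** Induction on the dimension. If [v] is nonzero beyond its first coordinate, each section is a
    hyperplane one dimension lower; otherwise the first coordinate of [x] is fixed to a single
    value. *)
Lemma lebesgue_cV_hyperplane (R : realType) (d : nat) (c : R) (v : 'cV[R]_d) :
  v != 0 -> lebesgue_cV R d [set x | dotv x v + c = 0] = 0%E.
Proof.
elim: d c v => [|d IH] c v v0; first by rewrite [v]flatmx0 eqxx in v0.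
rewrite [LHS](_ : _ = (lebesgue_measure \x lebesgue_cV R d)%E
  (@vcons R d @^-1` [set x | dotv x v + c = 0]))//.
have [v'0|v'0] := eqVneq (vuncons v).2 0; last first.
  apply: integral0_eq => x _ /=.
  rewrite [X in lebesgue_cV R d X](_ : _ =
    [set y | dotv y (vuncons v).2 + (x * (vuncons v).1 + c) = 0]); first exact: IH.
  by apply/seteqP; split => y; rewrite xsectionE/= dotv_vuncons vconsK/= -addrA addrCA.
have v00 : (vuncons v).1 != 0.
  apply: contraNneq v0 => v00; rewrite -dotvv_eq0 dotv_vuncons v'0 v00 mul0r add0r.
  by rewrite dotvv_eq0.
apply/eqP; rewrite eq_le measure_ge0 andbT.
have m1 : measurable [set - c / (vuncons v).1] by exact: measurable_set1.
apply: (@le_trans _ _ ((lebesgue_measure \x lebesgue_cV R d)%E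
    ([set - c / (vuncons v).1] `*` [set: 'cV[R]_d]))).
  apply: le_measure; rewrite ?inE.
  - rewrite -[X in measurable X]setTI.
    apply: measurable_vcons => //; exact: measurable_hyperplane.
  - exact: measurableX.
  - move=> [x y]; rewrite /= dotv_vuncons v'0 vconsK.
    rewrite [dotv _ 0](_ : _ = 0); last by rewrite /dotv mulmx0 mxE.
    rewrite addr0 => /eqP; rewrite addr_eq0 => /eqP xv; split => //.
    by rewrite -xv mulfK.
rewrite product_measure1E//.
(* The product is 0 even if the second factor is infinite. *)
rewrite [X in (X * _)%E](_ : _ = 0%E) ?mul0e//; exact: lebesgue_measure_set1.
Qed.

(** * Independence and the joint law of head and tail *)

Lemma mutually_independent_comp disp (Omega : measurableType disp) (R : realType)
    (P : probability Omega R) disp' (T : measurableType disp') (n k : nat)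
    (X : 'I_n -> {RV P >-> T}) (f : 'I_k -> 'I_n) :
  injective f -> mutually_independent X -> mutually_independent (X \o f).
Proof.
move=> f_inj X_indep J A mA.
(* The sets are carried along [f]; an index outside its image gets the full space, so that every set
   is measurable. *)
pose A' i := if [pick l | f l == i] is Some l then A l else setT.
have A'f l : A' (f l) = A l.
  rewrite /A'; case: pickP => [l' /eqP/f_inj ->//|/(_ l)]; by rewrite eqxx.
have mA' i : measurable (A' i) by rewrite /A'; case: pickP.
have := X_indep (f @: J)%SET A' mA'.
rewrite big_imset/=; last by move=> ? ? _ _; exact: f_inj.
under eq_bigr do rewrite A'f.
move=> <-; congr (P _); apply/seteqP; split => w /= h.
  by move=> _ /imsetP[l lJ ->]; rewrite /= A'f; exact: h.
by move=> l lJ; have := h (f l) (imset_f _ lJ); rewrite /= A'f.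
Qed.

(** Boxes, unlike the one-coordinate cylinders, are closed under intersection, so finite measures on
    tuples can be compared on them. *)
Lemma measurable_tuple_boxes disp (T : measurableType disp) (k : nat) :
  @measurable _ (k.-tuple T) =
  <<s [set B | exists2 A : 'I_k -> set T, (forall i, measurable (A i)) &
         B = [set z | forall i, A i (tnth z i)]] >>.
Proof.
apply/seteqP; split.
  apply: smallest_sub; first exact: smallest_sigma_algebra.
  move=> B; rewrite -bigcup_seq => -[i _ [A mA <-]].
  apply: sub_sigma_algebra.
  exists (fun j => if j == i then A else setT); first by move=> j; case: ifP.
  rewrite setTI; apply/seteqP; split => z /=.
    by move=> Az j; case: eqP => // ->.
  by move=> /(_ i); rewrite eqxx.
apply: smallest_sub; first exact: sigma_algebra_measurable.
move=> _ [A mA ->]; rewrite [X in measurable X](_ : _ =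
    \bigcap_(i in [set: 'I_k]) ((fun z => tnth z i) @^-1` A i)).
  apply: fin_bigcap_measurable => // i _.
  rewrite -[X in measurable X]setTI; exact: measurable_tnth.
by apply/seteqP; split => z /= h i; [move=> _|]; exact: h.
Qed.

(** For fixed [A] both sides are finite measures in [B]. They agree on boxes by mutual independence,
    hence everywhere. *)
Lemma independent_head_tail disp (Omega : measurableType disp) (R : realType)
    (P : probability Omega R) disp' (T : measurableType disp') (k : nat)
    (X : 'I_k.+1 -> {RV P >-> T}) (Z : Omega -> k.-tuple T) :
  mutually_independent X ->
  (forall w j, tnth (Z w) j = X (lift ord0 j) w) ->
  forall B A, measurable B -> measurable A ->
  P (Z @^-1` B `&` X ord0 @^-1` A) = (P (Z @^-1` B) * P (X ord0 @^-1` A))%E.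
Proof.
move=> X_indep ZX B A mB mA.
have mZ : measurable_fun setT Z.
  apply/measurable_fun_tnthP => j; rewrite (_ : _ \o _ = X (lift ord0 j)) //.
  by apply/funext => w /=; rewrite ZX.
have mXA : measurable (X ord0 @^-1` A) by rewrite -[X in measurable X]setTI; exact: measurable_funP.
pose Zm : {mfun Omega >-> k.-tuple T} :=
  HB.pack Z (isMeasurableFun.Build _ _ _ _ Z mZ).
have PA : P (X ord0 @^-1` A) \is a fin_num by exact: fin_num_measure.
have PA0 : 0 <= fine (P (X ord0 @^-1` A)) by rewrite fine_ge0.
have [m1 m1E] : exists m : {measure set (k.-tuple T) -> \bar R},
    forall C, m C = P (Z @^-1` C `&` X ord0 @^-1` A).
  unshelve eexists (pushforward (mrestr P mXA) Zm); first exact: mZ.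
  by [].
pose m2 := mscale (NngNum PA0) (distribution P Zm).
suff : m1 B = m2 B by rewrite m1E /m2 /= /mscale /distribution /pushforward /= fineK// muleC.
apply: (measure_unique _ (fun=> setT) (measurable_tuple_boxes T k)) => //.
- move=> _ _ [A1 mA1 ->] [A2 mA2 ->]; exists (fun i => A1 i `&` A2 i).
    by move=> i; exact: measurableI.
  apply/seteqP; split => z /=; first by move=> [h1 h2] i; split.
  by move=> h; split => i; have [] := h i.
- by move=> _; exists (fun=> setT) => //; apply/seteqP; split.
- by rewrite bigcup_const//; exists 0%N.
- move=> _ [A' mA' ->].
  set box := [set z | _].
  have boxE A0 : measurable A0 -> P (Z @^-1` box `&` X ord0 @^-1` A0) =
      (P (X ord0 @^-1` A0) * \prod_(j < k) P (X (lift ord0 j) @^-1` A' j))%E.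
    move=> mA0; pose A'' i := if unlift ord0 i is Some j then A' j else A0.
    have mA'' i : measurable (A'' i) by rewrite /A''; case: unlift.
    have := X_indep [set: 'I_k.+1]%SET A'' mA''.
    rewrite (eq_bigl xpredT) => [|i]; last by rewrite finset.in_setT.
    rewrite big_ord_recl {2}/A'' unlift_none.
    under eq_bigr do rewrite /A'' liftK.
    move=> <-; congr (P _); apply/seteqP; split => w /=.
      move=> [hb h0] i _; rewrite /= /A''; case: unliftP => [j|] -> //.
      by rewrite -ZX; exact: hb.
    move=> h; split; last by have := h ord0; rewrite /= /A'' unlift_none inE; exact.
    by move=> j; have := h (lift ord0 j); rewrite /= /A'' liftK inE ZX; exact.
  rewrite m1E /m2 /= /mscale /distribution /pushforward /= fineK//.
  rewrite boxE//; congr (_ * _)%E.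
  (* The full space for the head identifies the remaining product as the probability that the tail
     lies in the box. *)
  have := boxE setT measurableT.
  by rewrite preimage_setT setIT probability_setT mul1e.
- move=> _; rewrite m1E.
  by rewrite ltey_eq fin_num_measure// preimage_setT setTI.
Qed.

(** * Affine independence and Gram determinants *)

Section affine_matrix.
Context (R : realType) (d k : nat).
Implicit Type x : 'I_k -> 'cV[R]_d.

(* The rows are the vectors (1, x_i), so that linear independence of the rows
   is affine independence of the x_i. *)
Definition affine_mx x : 'M[R]_(k, d.+1) :=
  \matrix_(i, j) vcons (1, x i) j ord0.

(** The Gram determinant detects dependent rows for every [k], also when the matrix is not square,
    and is measurable as a polynomial in the entries. *)
Definition affine_gram x : R := \det (affine_mx x *m (affine_mx x)^T).

Lemma affine_mx_dotv x (u : 'cV[R]_d.+1) i :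
  (affine_mx x *m u) i ord0 = dotv (vcons (1, x i)) u.
Proof. by rewrite mxE dotvE; apply: eq_bigr => j _; rewrite mxE. Qed.

(** If [w] annihilates the Gram matrix, then [w *m affine_mx x] has squared Euclidean norm 0. *)
Lemma affine_gram_eq0P x :
  reflect (exists2 w : 'rV[R]_k, w != 0 & w *m affine_mx x = 0)
          (affine_gram x == 0).
Proof.
rewrite /affine_gram; apply: (iffP det0P) => -[w w0 wM]; exists w => //; last first.
  by rewrite mulmxA wM mul0mx.
have : dotv (w *m affine_mx x)^T (w *m affine_mx x)^T = 0.
  by rewrite /dotv trmxK trmx_mul mulmxA -(mulmxA w) wM mul0mx mxE.
by move/eqP; rewrite dotvv_eq0 => /eqP/(congr1 trmx); rewrite trmxK trmx0.
Qed.

End affine_matrix.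

Lemma measurable_affine_gram (R : realType) (d k : nat) disp (T : measurableType disp)
    (x : T -> 'I_k -> 'cV[R]_d) :
  (forall i, measurable_fun setT (fun w => x w i)) ->
  measurable_fun setT (fun w => affine_gram (x w)).
Proof.
move=> mx; apply: measurable_sum => s; apply: measurable_funM => //.
apply: measurable_prod => i _.
under eq_fun do rewrite mxE.
apply: measurable_sum => j.
have entry l : measurable_fun setT (fun w => affine_mx (x w) l j).
  under eq_fun do rewrite mxE.
  case: (unliftP ord0 j) => [h ->|->].
    under eq_fun do rewrite vconsES/=.
    exact: (measurableT_comp (measurable_coord h)).
  by under eq_fun do rewrite vconsE0/=; exact: measurable_cst.
apply: measurable_funM; first exact: entry.
by under eq_fun do rewrite mxE; exact: entry.
Qed.

(** If the linear part of [u] vanishes, its constant part does not and the set is empty; otherwise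
    it is a hyperplane. *)
Lemma lebesgue_cV_affine_hyperplane (R : realType) (d : nat) (u : 'cV[R]_d.+1) :
  u != 0 -> lebesgue_cV R d [set x | dotv (vcons (1, x)) u = 0] = 0%E.
Proof.
move=> u0.
rewrite [X in lebesgue_cV R d X](_ : _ =
    [set x | dotv x (vuncons u).2 + (vuncons u).1 = 0]); last first.
  by apply/seteqP; split => x /=; rewrite dotv_vuncons vconsK mul1r addrC.
have [u20|] := eqVneq (vuncons u).2 0; last exact: lebesgue_cV_hyperplane.
rewrite u20 [X in lebesgue_cV R d X](_ : _ = set0) ?measure0//.
apply/seteqP; split => x //=.
rewrite /dotv mulmx0 mxE add0r => u10.
move: u0; rewrite -dotvv_eq0 dotv_vuncons u20 /= u10 mul0r add0r.
by rewrite /dotv mulmx0 mxE eqxx.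
Qed.

Lemma measurable_eq0 disp (T : measurableType disp) (R : realType) (f : T -> R) :
  measurable_fun setT f -> measurable [set w | f w = 0].
Proof.
move=> mf; rewrite [X in measurable X](_ : _ = f @^-1` [set 0])//.
rewrite -[X in measurable X]setTI; apply: mf => //; exact: measurable_set1.
Qed.

(** As [k <= d], some nonzero [u] is orthogonal to all rows of the tail. In a dependence created by
    [y], the coefficient of [y] is nonzero, since otherwise the tail would be dependent; pairing
    with [u] leaves only the term of [y]. *)
Lemma affine_gram_cons_subset (R : realType) (d k : nat)
    (x : 'I_k.+1 -> 'cV[R]_d) : (k <= d)%N ->
  affine_gram (fun j => x (lift ord0 j)) != 0 ->
  exists2 u : 'cV[R]_d.+1, u != 0 &
    forall y, affine_gram (fun i => if unlift ord0 i is Some j then x (lift ord0 j) else y) = 0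
      -> dotv (vcons (1, y)) u = 0.
Proof.
move=> kd; set z := fun j => _ => gz.
have rkz : (\rank (affine_mx z) < d.+1)%N by rewrite (leq_ltn_trans (rank_leq_row _)).
have [v v0 vz] : exists2 v : 'rV[R]_d.+1, v != 0 & v *m (affine_mx z)^T = 0.
  have : kermx (affine_mx z)^T != 0.
    by rewrite -mxrank_eq0 mxrank_ker mxrank_tr subn_eq0 -ltnNge.
  by case/rowV0Pn => v /sub_kermxP vz v0; exists v.
exists v^T; first by rewrite trmx_eq0.
move=> y /eqP/affine_gram_eq0P[w w0].
set x' := fun i => _ => wx'.
have x'0 : x' ord0 = y by rewrite /x' unlift_none.
have x'S j : x' (lift ord0 j) = z j by rewrite /x' liftK.
have zu j : dotv (vcons (1, z j)) v^T = 0.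
  by rewrite -affine_mx_dotv -[affine_mx z]trmxK -trmx_mul vz trmx0 mxE.
have wy : w ord0 ord0 * dotv (vcons (1, y)) v^T = 0.
  have : (w *m affine_mx x' *m v^T) ord0 ord0 = 0 by rewrite wx' mul0mx mxE.
  rewrite -mulmxA mxE big_ord_recl affine_mx_dotv x'0 big1 ?addr0// => j _.
  by rewrite affine_mx_dotv x'S zu mulr0.
have [w00|w00] := eqVneq (w ord0 ord0) 0; last first.
  by move/eqP: wy; rewrite mulf_eq0 (negbTE w00) => /eqP.
case/negP: gz; apply/affine_gram_eq0P.
exists (\row_j w ord0 (lift ord0 j)).
  apply: contraNneq w0 => w'0; apply/eqP/rowP => i; rewrite [RHS]mxE.
  case: (unliftP ord0 i) => [j ->|-> //].
  by have := congr1 (fun M : 'rV_k => M ord0 j) w'0; rewrite !mxE.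
apply/rowP => l; have := congr1 (fun M : 'rV_d.+1 => M ord0 l) wx'.
rewrite [LHS]mxE [RHS]mxE big_ord_recl w00 mul0r add0r => wl.
rewrite [RHS]mxE -[RHS]wl mxE; by apply: eq_bigr => j _; rewrite !mxE x'S.
Qed.

(** Induction on [k]. The joint law of tail and head is a product, so it suffices that the sections
    over independent tails are null; each lies in a hyperplane. *)
Lemma affine_gram_ae_neq0 (R : realType) disp (Omega : measurableType disp)
    (P : probability Omega R) (d k : nat) (X : 'I_k -> {RV P >-> 'cV[R]_d}) :
  (k <= d.+1)%N -> mutually_independent X ->
  (forall j, distribution P (X j) `<< lebesgue_cV R d) ->
  P [set w | affine_gram (fun j => X j w) = 0] = 0%E.
Proof.
elim: k X => [|k IH] X kd X_indep X_ac.
  rewrite [X in P X](_ : _ = set0) ?measure0//.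
  by apply/seteqP; split => w //=; rewrite /affine_gram det_mx00 => /eqP; rewrite oner_eq0.
pose X' := X \o lift ord0.
have P'0 : P [set w | affine_gram (fun j => X' j w) = 0] = 0%E.
  apply: IH; first exact: ltnW.
    by apply: mutually_independent_comp => //; exact: lift_inj.
  by move=> j; exact: X_ac.
pose Z w : k.-tuple 'cV[R]_d := [tuple X' j w | j < k].
have ZX w j : tnth (Z w) j = X' j w by rewrite tnth_mktuple.
have mZ : measurable_fun setT Z.
  apply/measurable_fun_tnthP => j; rewrite (_ : _ \o _ = X' j) //.
  by apply/funext => w /=; rewrite ZX.
pose Zm : {mfun Omega >-> k.-tuple 'cV[R]_d} :=
  HB.pack Z (isMeasurableFun.Build _ _ _ _ Z mZ).
pose fam (z : k.-tuple 'cV[R]_d) (y : 'cV[R]_d) (i : 'I_k.+1) :=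
  if unlift ord0 i is Some j then tnth z j else y.
pose B := [set p : k.-tuple 'cV[R]_d * 'cV[R]_d | affine_gram (fam p.1 p.2) = 0].
have mB : measurable B.
  apply: measurable_eq0; apply: measurable_affine_gram => i; rewrite /fam.
  case: unlift => [j|]; last exact: measurable_snd.
  exact: (measurableT_comp (measurable_tnth j) measurable_fst).
pose N := [set z : k.-tuple 'cV[R]_d | affine_gram (tnth z) = 0].
have mN : measurable N.
  by apply: measurable_eq0; apply: measurable_affine_gram => i; exact: measurable_tnth.
have mp : measurable_fun setT (fun w => (Z w, X ord0 w)) by exact: measurable_fun_pair.
have [m' m'E] : exists m : {measure set (k.-tuple 'cV[R]_d * 'cV[R]_d) -> \bar R},
    forall C, m C = P ((fun w => (Z w, X ord0 w)) @^-1` C).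
  by unshelve eexists (pushforward P (fun w => (Z w, X ord0 w))); first exact: mp.
have -> : P [set w | affine_gram (fun j => X j w) = 0] = m' B.
  rewrite m'E; congr (P _); apply/seteqP.
  have eqX w : fam (Z w) (X ord0 w) = (fun j => X j w).
    apply/funext => i; rewrite /fam; case: unliftP => [j|] -> //.
  by split => w; rewrite /B /= eqX.
rewrite -(@product_measure_unique _ _ _ _ _ (distribution P Zm) (distribution P (X ord0)) m')//; last first.
  move=> C A mC mA; rewrite m'E -[RHS](independent_head_tail X_indep)//.
have N0 : distribution P Zm N = 0%E.
  rewrite -P'0; congr (P _); apply/seteqP.
  have eqX w : tnth (Z w) = (fun j => X' j w) by apply/funext => j; exact: ZX.
  by split => w /=; rewrite /N /= eqX.
(* The section probability is at most 1 on the null set [N] and 0 off it, so its integral is at most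
   that of the indicator of [N]. *)
apply/eqP; rewrite eq_le measure_ge0 andbT -N0.
rewrite -[X in (_ <= distribution _ _ X)%E]setIT -[leRHS]integral_indic//.
apply: ge0_le_integral => //.
- exact: measurable_fun_xsection.
- by apply/measurable_EFinP; exact: measurable_indic.
move=> z _ /=; rewrite indicE.
have [zN|zN] := boolP (z \in N); first exact: probability_le1 (measurable_xsection _ mB).
rewrite [leLHS](_ : _ = 0%E)//.
have {}zN : affine_gram (tnth z) != 0 by apply: contraNneq zN => zN; rewrite inE.
(* The head 0 is a placeholder: [affine_gram_cons_subset] reads only the tail of the family. *)
have [|u u0 hu] := @affine_gram_cons_subset R d k (fam z 0) kd.
  rewrite (_ : (fun _ => _) = tnth z)//.
  by apply/funext => j; rewrite /fam liftK.
apply: (X_ac ord0 [set y | dotv (vcons (1, y)) u = 0]).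
- apply/measure0_null_setP; last exact: lebesgue_cV_affine_hyperplane.
  apply: measurable_eq0; apply: (measurableT_comp (measurable_dotv u)).
  apply: (measurableT_comp (@measurable_vcons R d)).
  exact: measurable_fun_pair.
- exact: measurable_xsection.
- move=> y; rewrite xsectionE /B /= => yB; apply: hu; rewrite -[RHS]yB.
  congr affine_gram; apply/funext => i; rewrite /fam.
  by case: unliftP => [j|] // _; rewrite liftK.
Qed.

(** * From affine independence to an invertible covariance *)

Lemma sample_cov_quadratic (R : realType) (d n : nat) (x : 'I_n -> 'cV[R]_d)
    (v : 'rV[R]_d) :
  (v *m sample_cov x *m v^T) ord0 ord0 =
  n%:R^-1 * \sum_(j < n) dotv (x j - sample_mean x) v^T ^+ 2.
Proof.
rewrite /sample_cov -scalemxAr -scalemxAl mxE; congr (_ * _).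
rewrite mulmx_sumr mulmx_suml summxE; apply: eq_bigr => j _.
rewrite (mulmxA v) -(mulmxA (v *m _)) mxE big_ord1 expr2; congr (_ * _).
by rewrite dotvC /dotv trmxK.
Qed.

(** A kernel vector [v] of the covariance gives the projections on [v] empirical variance 0. All
    points then share the projection of the mean, so every [(1, x j)] is orthogonal to
    [(- v . mean, v)]. *)
Lemma sample_cov_unit (R : realType) (d n : nat) (x : 'I_n -> 'cV[R]_d)
    (f : 'I_d.+1 -> 'I_n) :
  affine_gram (x \o f) != 0 -> sample_cov x \in unitmx.
Proof.
move=> gx; have n0 : (0 < n)%N by apply: leq_ltn_trans (ltn_ord (f ord0)).
apply: contraNT gx; rewrite unitmxE unitfE negbK => /det0P[v v0 vS].
have := sample_cov_quadratic x v.
rewrite vS mul0mx mxE => /esym/eqP.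
rewrite mulf_eq0 invr_eq0 pnatr_eq0 gtn_eqF//= psumr_eq0; last first.
  by move=> j _; rewrite sqr_ge0.
move=> /allP xv.
have {}xv j : dotv (x j) v^T = dotv (sample_mean x) v^T.
  have := xv j (mem_index_enum j); rewrite /= sqrf_eq0 => /eqP xv0.
  by rewrite -[x j](subrK (sample_mean x)) dotvDl xv0 add0r.
(* With [d.+1] points the affine matrix is square, and its Gram determinant is the square of its
   determinant. *)
rewrite /affine_gram det_mulmx det_tr mulf_eq0 orbb.
rewrite -det_tr; apply/det0P.
pose u : 'cV[R]_d.+1 := vcons (- dotv (sample_mean x) v^T, v^T).
exists u^T.
  rewrite trmx_eq0; apply: contraNneq v0 => u0.
  have : (vuncons u).2 = 0 by rewrite u0; apply/matrixP => i j; rewrite !mxE.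
  by rewrite vconsK/= => /eqP; rewrite trmx_eq0.
rewrite -trmx_mul; apply/eqP; rewrite trmx_eq0; apply/eqP/matrixP => i j.
rewrite ord1 affine_mx_dotv dotv_vuncons !vconsK/= xv mul1r addNr.
by rewrite mxE.
Qed.

Lemma sample_cov_ae_unit (R : realType) disp (Omega : measurableType disp)
    (P : probability Omega R) (d n : nat) (X : 'I_n -> {RV P >-> 'cV[R]_d}) :
  (d < n)%N -> mutually_independent X ->
  (forall j, distribution P (X j) `<< lebesgue_cV R d) ->
  {ae P, forall w, sample_cov (fun j => X j w) \in unitmx}.
Proof.
(* The first [d.+1] observations are selected; their affine independence suffices. *)
move=> dn X_indep X_ac; pose f := widen_ord dn.
have f_inj : injective f by move=> i j /(congr1 val) /= ij; exact: val_inj.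
exists [set w | affine_gram (fun j => X (f j) w) = 0]; split.
- by apply: measurable_eq0; apply: measurable_affine_gram => i; exact: measurable_funP.
- apply: (@affine_gram_ae_neq0 _ _ _ _ _ _ (X \o f)) => //.
    exact: mutually_independent_comp.
  by move=> j; exact: X_ac.
- move=> w /=; apply: contra_notP => /eqP gw.
  exact: (@sample_cov_unit _ _ _ (fun j => X j w) f).
Qed.

Unset Implicit Arguments.

Theorem theorem4p1 (R : realType) (disp : measure_display)
  (Omega : measurableType disp) (P : probability Omega R) (d n : nat)
  (d_gt0 : (0 < d)%N) (n_ge : (d.+1 <= n)%N)
  (X : 'I_n -> {RV P >-> 'cV[R]_d})
  (X_indep : mutually_independent X)
  (X_id : identically_distributed X)
  (X_ac : forall j, distribution P (X j) `<< lebesgue_cV R d) :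
  {ae P, forall omega, sample_cov (fun j => X j omega) \in unitmx} /\
  forall omega : Omega,
    let x := fun j => X j omega in
    sample_cov x \in unitmx ->
    gamma `^ (3 + d%:R / 2) *
      (96 * Tn x gamma / (n%:R * pi `^ (d%:R / 2))) @[gamma --> +oo]
    --> 2 * b1 x + 3 * b1_tilde x.
Proof.
split; first exact: sample_cov_ae_unit.
by move=> omega x _; apply: cvg_Tn; exact: leq_ltn_trans n_ge.
Qed.
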